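(* Let $\mathcal{C}$ be a hereditary class of graphs and $c\ge1$. Assume that $\mathcal{C}'$ is a class of graphs having the $\mathcal{O}(n^c)$-CS-Separation property. If every prime atom of $\mathcal{C}$ is nearly-$\mathcal{C}'$, then $\mathcal{C}$ has the $\mathcal{O}(n^{c+3})$-CS-Separation property.
   Context: Graphs are finite and simple; a class is hereditary if closed under taking induced subgraphs. A cut of $G$ is a partition $(W,W')$ of $V(G)$; it separates disjoint $K,S$ if $K\subseteq W$, $S\subseteq W'$. A CS-Separator of $G$ is a family of cuts such that every clique $K$ and stable set $S$ with $K\cap S=\emptyset$ are separated by some cut; its size is the number of cuts. A class $\mathcal{D}$ has the $\mathcal{O}(n^k)$-CS-Separation property if there is a constant $A$ such that every $H\in\mathcal{D}$ has a CS-Separator of size at most $A|V(H)|^k$. A module of $G$ is a set $M\subseteq V(G)$ such that every vertex outside $M$ is adjacent to all or to none of $M$; it is trivial if $|M|=1$ or $M=V(G)$; $G$ is prime if all its modules are trivial. A clique-cutset is a set $C$ inducing a clique such that $G\setminus C$ is disconnected; an atom is a graph with no clique-cutset. $G$ is nearly-$\mathcal{C}'$ if for every $v\in V(G)$, $G\setminus N[v]\in\mathcal{C}'$, where $N[v]$ is $v$ together with its neighbors. *)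

(* Defs.v *)
From mathcomp Require Import all_boot all_order all_algebra.
From mathcomp Require Import reals exp.

Set Implicit Arguments.
Unset Strict Implicit.
Unset Printing Implicit Defensive.

Record sgraph := SGraph {
  vertex :> finType;
  adj : rel vertex;
  adj_sym : symmetric adj;
  adj_irr : irreflexive adj }.

Lemma induced_sym (G : sgraph) (W : {set G}) :
  symmetric (fun x y : {x : G | x \in W} => adj (val x) (val y)).
Proof. by move=> x y; apply: adj_sym. Qed.

Lemma induced_irr (G : sgraph) (W : {set G}) :
  irreflexive (fun x y : {x : G | x \in W} => adj (val x) (val y)).
Proof. by move=> x; apply: adj_irr. Qed.

Definition induced (G : sgraph) (W : {set G}) : sgraph :=
  SGraph (@induced_sym G W) (@induced_irr G W).

(* Induced subgraphs are taken up to isomorphism, so that a hereditary class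
   is in particular closed under isomorphism. *)
Definition induced_subgraph (H G : sgraph) : Prop :=
  exists f : H -> G, injective f /\ forall x y, adj (f x) (f y) = adj x y.

Definition graph_class := sgraph -> Prop.

Definition hereditary (C : graph_class) : Prop :=
  forall G H : sgraph, C G -> induced_subgraph H G -> C H.

Section Notions.
Variable G : sgraph.
Implicit Types K S W M C : {set G}.

Definition clique K : Prop := {in K &, forall x y, x != y -> adj x y}.

Definition stable S : Prop := {in S &, forall x y, ~~ adj x y}.

(* The cut (W, V(G) \ W) is represented by its first side W; either side may
   be empty. *)
Definition separates W K S : Prop := K \subset W /\ S \subset ~: W.

Definition cs_separator (F : {set {set G}}) : Prop :=
  forall K S, clique K -> stable S -> [disjoint K & S] ->
  exists2 W, W \in F & separates W K S.

(* Modules are nonempty: otherwise the empty set would be a nontrivial module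
   of every nonempty graph, and none of these would be prime. *)
Definition graph_module M : Prop :=
  M != set0 /\
  forall x, x \notin M ->
    {in M, forall y, adj x y} \/ {in M, forall y, ~~ adj x y}.

Definition trivial_module M : Prop := #|M| = 1 \/ M = [set: G].

Definition prime_graph : Prop := forall M, graph_module M -> trivial_module M.

(* The graph without vertices is not disconnected. *)
Definition disconnected : Prop := exists x y : G, ~~ connect (@adj G) x y.

Definition closed_neigh (v : G) : {set G} := [set x | (x == v) || adj v x].

End Notions.

(* C may be empty, so an atom is connected. *)
Definition clique_cutset (G : sgraph) (C : {set G}) : Prop :=
  clique C /\ disconnected (induced (~: C)).

Definition atom (G : sgraph) : Prop := forall C : {set G}, ~ clique_cutset C.

Definition nearly (C : graph_class) (G : sgraph) : Prop :=
  forall v : G, C (induced (~: closed_neigh v)).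

Local Open Scope ring_scope.

(* The graph without vertices is a legitimate member of a class, but it is
   exempted from the bound: it needs one cut (for K = S = set0), whereas
   0 `^ k = 0 for k != 0. *)
Definition CS_separation_property (R : realType) (k : R) (D : graph_class)
  : Prop :=
  exists A : R, forall H : sgraph, D H -> (0 < #|H|)%N ->
  exists F : {set {set H}},
    cs_separator F /\ (#|F|%:R <= A * #|H|%:R `^ k).

(* Main.v *)
(** Let n be the order of a graph and m its number of ordered nonadjacent
    pairs.  By strong induction on n, every nonempty graph of the class has a
    CS-separator of size at most B (m + 1) max(n - 1, 1) n^c.
    - Prime atom: if S contains v, then a cut of G \ N[v] separating the traces
      of K and S becomes a cut of G after adding N(v) to the side of K; this
      costs 1 + n max(A, 1) n^c.
    - Module M: substitution yields a separator from those of G[M] and of the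
      graph in which M is contracted to one of its vertices.  The quantity n - 1
      is additive and m is superadditive.
    - Clique-cutset C: every clique lies in one of the two pieces, so their
      separators together separate G.  As C has no nonadjacent pair and two
      vertices across C are nonadjacent, m + 1 is superadditive.
    Finally (m + 1) max(n - 1, 1) <= n^3. *)
Require Import Defs.
From mathcomp Require Import all_boot all_order all_algebra.
From mathcomp Require Import boolp reals exp.
From mathcomp Require Import zify lra.

Set Implicit Arguments.
Unset Strict Implicit.
Unset Printing Implicit Defensive.

Import Order.TTheory GRing.Theory Num.Theory.

(** * Separators of an induced subgraph, as cuts of the whole graph *)

Definition separates_on (G : sgraph) (W : {set G}) (F : {set {set G}}) : Prop :=
  forall K S : {set G}, K \subset W -> S \subset W -> clique K -> stable S ->
  [disjoint K & S] -> exists2 U, U \in F & separates U K S.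

Lemma induced_subgraph_induced (G : sgraph) (W : {set G}) :
  induced_subgraph (induced W) G.
Proof. by exists val; split=> //; apply: val_inj. Qed.

Lemma card_induced (G : sgraph) (W : {set G}) : #|induced W| = #|W|.
Proof. exact: card_sig. Qed.

Lemma clique_sub (G : sgraph) (K L : {set G}) :
  K \subset L -> clique L -> clique K.
Proof. by move=> /subsetP sKL cL x y /sKL xL /sKL yL; apply: cL. Qed.

Lemma stable_sub (G : sgraph) (S T : {set G}) :
  S \subset T -> stable T -> stable S.
Proof. by move=> /subsetP sST sT x y /sST xT /sST yT; apply: sT. Qed.

(** Cuts are transported as images under [val], so they stay inside [W] and leave every vertex
    outside [W] on the stable side. The gluing arguments below rely on this inclusion. *)
Lemma lift_separator (G : sgraph) (W : {set G}) (F : {set {set induced W}}) :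
  cs_separator F ->
  exists F' : {set {set G}}, [/\ #|F'| <= #|F|, separates_on W F' &
    (forall U, U \in F' -> U \subset W)].
Proof.
move=> sepF; exists [set val @: U | U : {set induced W} in F]; split.
- exact: leq_imset_card.
- move=> K S sKW sSW cK sS dKS.
  have [||| U UF [KU SU]] := sepF (val @^-1: K) (val @^-1: S).
  + by move=> x y; rewrite !inE => xK yK nxy; apply: cK.
  + by move=> x y; rewrite !inE => xS yS; apply: sS.
  + apply/pred0P => x /=; rewrite !inE; apply/negP => /andP[xK xS].
    by move: (disjointFr dKS xK); rewrite xS.
  exists (val @: U); first exact: imset_f.
  split; apply/subsetP => x.
  + move=> xK; have xW := subsetP sKW x xK.
    apply/imsetP; exists (Sub x xW : induced W) => //.
    by apply: (subsetP KU); rewrite inE.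
  + move=> xS; rewrite inE; apply/negP => /imsetP[y yU xy].
    have: y \in val @^-1: S by rewrite inE -xy.
    by move/(subsetP SU); rewrite inE yU.
- move=> _ /imsetP[U _ ->]; apply/subsetP => _ /imsetP[x _ ->]; exact: valP.
Qed.

(** * Gluing separators: neighbourhoods, modules, clique-cutsets *)

Lemma nearly_separator (G : sgraph) (F : G -> {set {set G}}) :
  (forall v, separates_on (~: closed_neigh v) (F v)) ->
  (forall v, (forall U, U \in F v -> U \subset ~: closed_neigh v)) ->
  exists E : {set {set G}}, cs_separator E /\ #|E| <= (\sum_v #|F v|).+1.
Proof.
move=> sepF subF.
pose N (v : G) := closed_neigh v :\ v.
(* [[set: G]] serves the empty stable set, the only one that offers no vertex [v]; it accounts for
   the successor in the bound. *)
exists ([set: G] |: \bigcup_v [set U :|: N v | U : {set G} in F v]); split.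
  move=> K S cK sS dKS.
  have [->|[v vS]] := set_0Vmem S.
    exists [set: G]; first by rewrite !inE eqxx.
    by split; [apply: subsetT | apply: sub0set].
  have dK x : x \in K -> x \notin S by move=> xK; rewrite (disjointFr dKS xK).
  have [||||| U UF [KU SU]] := sepF v (K :\: closed_neigh v) (S :\ v).
  - by rewrite setDE subsetIr.
  - apply/subsetP => x /setD1P[nxv xS]; rewrite !inE negb_or nxv.
    exact: sS.
  - exact: clique_sub (subsetDl _ _) cK.
  - exact: stable_sub (subsetDl _ _) sS.
  - apply/pred0P => x /=; apply/negP => /andP[/setDP[/dK/negP nxS _]].
    by case/setD1P.
  exists (U :|: N v).
    by apply/setU1P; right; apply/bigcupP; exists v => //; apply: imset_f.
  split; apply/subsetP => x.
    move=> xK; have [xN|xN] := boolP (x \in closed_neigh v).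
      rewrite !inE in xN *; rewrite xN andbT; apply/orP; right.
      by apply: contraNneq (dK _ xK) => ->.
    by rewrite inE (subsetP KU) // inE xN.
  move=> xS; rewrite !inE negb_or; have [->|nxv] := eqVneq x v.
    rewrite andbT; apply/negP => vU.
    by have := subsetP (subF v U UF) v vU; rewrite !inE eqxx.
  rewrite (negbTE (sS v x vS xS)) andbT.
  by have := subsetP SU x; rewrite !inE nxv xS => ->.
rewrite -add1n; apply: leq_trans (leq_card_setU _ _) _; rewrite cards1 leq_add2l.
elim/big_rec2: _ => [|v k X _ Xk]; first by rewrite cards0.
apply: leq_trans (leq_card_setU _ _) _.
by rewrite leq_add // leq_imset_card.
Qed.

(** If [K] and [S] both meet [M], then the vertices of [K] outside [M] are complete to [M] and those
    of [S] outside [M] have no neighbour in it, so a cut of [M] is extended by the outer neighbours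
    [N]. Otherwise the contraction [p] of [M] to [m] keeps the images of [K] and [S] disjoint, and
    the preimage under [p] of a cut separates [K] from [S]. *)
Lemma module_separator (G : sgraph) (M : {set G}) (m : G)
    (F1 F2 : {set {set G}}) :
  graph_module M -> m \in M ->
  separates_on M F1 -> (forall U, U \in F1 -> U \subset M) ->
  separates_on (m |: ~: M) F2 ->
  exists E : {set {set G}}, cs_separator E /\ #|E| <= #|F1| + #|F2|.
Proof.
move=> [_ modM] mM sep1 sub1 sep2.
have adjM x y z : x \notin M -> y \in M -> z \in M -> adj x y = adj x z.
  move=> /modM[] xM yM zM; first by rewrite !xM.
  by rewrite (negbTE (xM y yM)) (negbTE (xM z zM)).
pose p x := if x \in M then m else x.
have adjp x y : ~~ ((x \in M) && (y \in M)) -> adj (p x) (p y) = adj x y.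
  rewrite /p; case: ifPn => xM; case: ifPn => yM //= _.
    by rewrite adj_sym (adjM y m x) // adj_sym.
  exact: adjM.
have pW x : p x \in m |: ~: M.
  by rewrite /p !inE; case: ifPn; rewrite ?eqxx // => ->; rewrite orbT.
pose N := [set x | (x \notin M) && adj x m].
exists ([set U :|: N | U : {set G} in F1] :|: [set p @^-1: U | U : {set G} in F2]); split; last first.
  by apply: leq_trans (leq_card_setU _ _) _; apply: leq_add; apply: leq_imset_card.
move=> K S cK sS dKS.
have dK x : x \in K -> x \notin S by move=> xK; rewrite (disjointFr dKS xK).
have [/andP[/set0Pn[k /setIP[kK kM]] /set0Pn[s /setIP[sinS sM]]]|nKS] :=
    boolP ((K :&: M != set0) && (S :&: M != set0)).
  have [||||| U UF [KU SU]] := sep1 (K :&: M) (S :&: M).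
  - exact: subsetIr.
  - exact: subsetIr.
  - exact: clique_sub (subsetIl _ _) cK.
  - exact: stable_sub (subsetIl _ _) sS.
  - by apply: disjointWl (subsetIl _ _) _; apply: disjointWr (subsetIl _ _) dKS.
  exists (U :|: N); first by apply/setUP; left; apply: imset_f.
  split; apply/subsetP => x.
    move=> xK; have [xM|xM] := boolP (x \in M).
      by rewrite inE (subsetP KU) // inE xK.
    rewrite !inE xM (adjM x m k) //= cK ?orbT //.
    by apply: contraNneq xM => ->.
  move=> xS; have [xM|xM] := boolP (x \in M).
    by have := subsetP SU x; rewrite !inE xS xM orbF => ->.
  rewrite !inE xM (adjM x m s) // (negbTE (sS x s xS sinS)) orbF.
  by apply: contra xM; apply/subsetP/sub1.
have nKSM x y : x \in K -> y \in S -> ~~ ((x \in M) && (y \in M)).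
  move=> xK yS; apply: contra nKS => /andP[xM yM].
  by apply/andP; split; apply/set0Pn; [exists x | exists y]; rewrite inE ?xK ?yS.
have [||||| U UF [KU SU]] := sep2 (p @: K) (p @: S).
- by apply/subsetP => _ /imsetP[x _ ->].
- by apply/subsetP => _ /imsetP[x _ ->].
- move=> _ _ /imsetP[x xK ->] /imsetP[y yK ->] npxy.
  rewrite adjp; last by apply: contra npxy => /andP[xM yM]; rewrite /p xM yM.
  by apply: cK => //; apply: contraNneq npxy => ->.
- move=> _ _ /imsetP[x xS ->] /imsetP[y yS ->].
  have [/andP[xM yM]|nM] := boolP ((x \in M) && (y \in M)).
    by rewrite /p xM yM adj_irr.
  by rewrite adjp //; apply: sS.
- apply/pred0P => z /=; apply/negP => /andP[/imsetP[x xK ->] /imsetP[y yS]].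
  have := nKSM x y xK yS; rewrite /p; case: ifPn => xM; case: ifPn => yM //= _ e.
  + by move: yM; rewrite -e mM.
  + by move: xM; rewrite e mM.
  + by move: (dK x xK); rewrite e yS.
exists (p @^-1: U); first by apply/setUP; right; apply: imset_f.
split; apply/subsetP => x xX; rewrite !inE.
  by apply: (subsetP KU); apply: imset_f.
by have := subsetP SU (p x); rewrite inE => -> //; apply: imset_f.
Qed.

Lemma cutset_separator (G : sgraph) (W1 W2 : {set G}) (F1 F2 : {set {set G}}) :
  W1 :|: W2 = [set: G] ->
  (forall x y, x \notin W2 -> y \notin W1 -> ~~ adj x y) ->
  separates_on W1 F1 -> (forall U, U \in F1 -> U \subset W1) ->
  separates_on W2 F2 -> (forall U, U \in F2 -> U \subset W2) ->
  exists E : {set {set G}}, cs_separator E /\ #|E| <= #|F1| + #|F2|.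
Proof.
move=> W12 nadj sep1 sub1 sep2 sub2.
have side (W : {set G}) F K S : separates_on W F -> (forall U, U \in F -> U \subset W) ->
    clique K -> stable S -> [disjoint K & S] -> K \subset W ->
    exists2 U, U \in F & separates U K S.
  move=> sepW subW cK sS dKS KW.
  (* Only the trace of [S] on [W] is handed to the separator; the rest of [S] avoids [U] because [U]
     lies inside [W]. *)
  have [||| U UF [KU SU]] := sepW K (S :&: W) KW _ cK.
  - exact: subsetIr.
  - exact: stable_sub (subsetIl _ _) sS.
  - exact: disjointWr (subsetIl _ _) dKS.
  exists U => //; split=> //; apply/subsetP => x xS; rewrite inE.
  apply/negP => xU; have xW := subsetP (subW U UF) x xU.
  by have := subsetP SU x; rewrite !inE xS xW xU => /(_ isT).
exists (F1 :|: F2); split; last exact: leq_card_setU.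
move=> K S cK sS dKS.
have [KW1|/subsetPn[y yK yW1]] := boolP (K \subset W1).
  by have [U UF ?] := side _ _ _ _ sep1 sub1 cK sS dKS KW1;
     exists U => //; rewrite inE UF.
have KW2 : K \subset W2.
  apply/subsetP => x xK; apply: contraT => xW2.
  have := nadj x y xW2 yW1; rewrite cK //.
  apply: contraNneq yW1 => <-.
  by have := in_setT x; rewrite -W12 inE (negbTE xW2) orbF.
by have [U UF ?] := side _ _ _ _ sep2 sub2 cK sS dKS KW2;
   exists U => //; rewrite inE UF orbT.
Qed.

(** With [A] the component of [x] in the graph without [C], the pieces are [A :|: C] and [~: A].
    They meet only inside [C]; the first misses [y], the second misses [x]. *)
Lemma cutset_split (G : sgraph) (C : {set G}) : clique_cutset C ->
  exists W1 W2 : {set G}, [/\ W1 :|: W2 = [set: G], clique (W1 :&: W2),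
    (forall x y, x \notin W2 -> y \notin W1 -> ~~ adj x y),
    ~~ ([set: G] \subset W1) & ~~ ([set: G] \subset W2)].
Proof.
case=> cC [x [y nxy]].
pose A : {set G} := val @: [set z : induced (~: C) | connect (@adj (induced (~: C))) x z].
have AC z : z \in A -> z \notin C.
  by case/imsetP => u _ ->; have := valP u; rewrite inE.
have xA : val x \in A by rewrite imset_f ?inE ?connect0.
have yA : val y \notin A.
  by apply: contra nxy => /imsetP[u]; rewrite inE => ? /val_inj->.
exists (A :|: C), (~: A); split.
- by apply/setP => z; rewrite !inE; case: (z \in A); rewrite ?orbT.
- by apply: (clique_sub _ cC); apply/subsetP => z; rewrite !inE; case: (z \in A); rewrite ?andbF /= ?andbT.
- move=> a b; rewrite !inE negbK negb_or => /imsetP[u]; rewrite inE => xu ->.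
  move=> /andP[bA bC]; apply: contra bA => ub.
  have bC' : b \in ~: C by rewrite inE.
  apply/imsetP; exists (Sub b bC' : induced (~: C)) => //; rewrite inE.
  exact: connect_trans xu (connect1 _).
- apply/subsetPn; exists (val y) => //; rewrite inE negb_or yA.
  by have := valP y; rewrite inE.
- by apply/subsetPn; exists (val x); rewrite // inE negbK.
Qed.

(** * Counting nonadjacent pairs *)

Definition nonadjacent_pairs (G : sgraph) : {set G * G} :=
  [set p | (p.1 != p.2) && ~~ adj p.1 p.2].

(** Diagonal pairs are never counted; the strict inequality leaves room for the successor in
    [weight]. *)
Lemma card_nonadjacent_pairs (G : sgraph) : 0 < #|G| ->
  #|nonadjacent_pairs G| < #|G| ^ 2.
Proof.
move=> /card_gt0P[x _]; rewrite expnS expn1 -card_prod -cardsT.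
apply: proper_card; apply/properP; split; first exact: subsetT.
by exists (x, x); rewrite ?inE //= eqxx.
Qed.

(** A pair counted on both sides would consist of two distinct nonadjacent vertices of the clique
    [W1 :&: W2]. The flag [b] adds a pair across the pieces, counted on neither side: it is [true]
    for clique-cutsets and [false] for modules. *)
Lemma nonadjacent_pairs_induced (G : sgraph) (W1 W2 : {set G}) (b : bool) :
  clique (W1 :&: W2) ->
  (b -> exists x y, [/\ x \notin W2, y \notin W1, x != y & ~~ adj x y]) ->
  #|nonadjacent_pairs (induced W1)| + #|nonadjacent_pairs (induced W2)| + b
    <= #|nonadjacent_pairs G|.
Proof.
move=> cW nb.
pose f (W : {set G}) (p : induced W * induced W) := (val p.1, val p.2).
have f_inj W : injective (f W) by move=> [? ?] [? ?] [/val_inj-> /val_inj->].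
pose Q W := f W @: nonadjacent_pairs (induced W).
have QP W p : p \in Q W -> [/\ p.1 \in W, p.2 \in W & p \in nonadjacent_pairs G].
  by case/imsetP=> -[u v]; rewrite !inE /= => uv ->; split=> //; apply: valP.
have dQ : [disjoint Q W1 & Q W2].
  apply/pred0P => p /=; apply/negP => /andP[/QP[p1 p2]].
  rewrite inE => /andP[ne /negP nadj] /QP[p1' p2' _]; apply: nadj.
  by apply: cW; rewrite ?inE ?p1 ?p2.
have QU : Q W1 :|: Q W2 \subset nonadjacent_pairs G.
  by apply/subsetP => p /setUP[] /QP[].
rewrite -(card_imset _ (@f_inj W1)) -(card_imset _ (@f_inj W2)) -/(Q W1) -/(Q W2).
have -> : #|Q W1| + #|Q W2| = #|Q W1 :|: Q W2|.
  by apply/eqP; rewrite eq_sym (leq_card_setU (Q W1) (Q W2)).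
case: b nb => [/(_ isT)[x [y [xW2 yW1 nxy nadj]]]|_]; rewrite ?addn0 ?addn1.
  apply: proper_card; apply/properP; split=> //; exists (x, y).
    by rewrite inE nxy.
  rewrite inE; apply/negP => /orP[] /QP[/= x_in y_in _].
    by rewrite y_in in yW1.
  by rewrite x_in in xW2.
exact: subset_leq_card.
Qed.

(** The [maxn] keeps the weight of a single vertex positive, where the predecessor of the order is
    0. *)
Definition weight (G : sgraph) : nat :=
  #|nonadjacent_pairs G|.+1 * maxn #|G|.-1 1.

Local Open Scope ring_scope.

(** * Size bounds and the induction on the order *)

Section Bound.
Variables (R : realType) (c : R).
Hypothesis c_ge0 : 0 <= c.

Definition separable (G : sgraph) (b : R) : Prop :=
  exists F : {set {set G}}, cs_separator F /\ #|F|%:R <= b.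

Lemma powR_nat_le m n : (m <= n)%N -> m%:R `^ c <= n%:R `^ c :> R.
Proof. by move=> mn; rewrite ge0_ler_powR ?nnegrE ?ler0n ?ler_nat. Qed.

Lemma powR_nat_ge1 n : (0 < n)%N -> 1 <= n%:R `^ c :> R.
Proof. by move/powR_nat_le; rewrite mulr1n powR1. Qed.

Lemma nearly_separable (G : sgraph) (A : R) (D : graph_class) :
  (forall H, D H -> (0 < #|H|)%N -> separable H (A * #|H|%:R `^ c)) ->
  nearly D G ->
  separable G (1 + #|G|%:R * (Num.max A 1 * #|G|%:R `^ c)).
Proof.
move=> sepD nearG.
have piece v : exists F : {set {set G}},
    [/\ separates_on (~: closed_neigh v) F,
        (forall U, U \in F -> U \subset ~: closed_neigh v) &
        #|F|%:R <= Num.max A 1 * #|G|%:R `^ c].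
  have G_gt0 : (0 < #|G|)%N by apply/card_gt0P; exists v.
  (* The bound for [D] exempts the graph without vertices. When [v] is adjacent to all other
     vertices, the single cut [set0] suffices, and the maximum with 1 pays for it. *)
  have [W0|W_gt0] := posnP #|~: closed_neigh v|.
    exists [set set0]; split.
    - move=> K S; rewrite (cards0_eq W0) !subset0 => /eqP-> /eqP-> _ _ _.
      by exists set0; rewrite ?inE //; split; rewrite sub0set.
    - by move=> U; rewrite inE => /eqP->; apply: sub0set.
    - by rewrite cards1 -[leLHS]mulr1 ler_pM ?ler01 ?le_max ?lexx ?orbT ?powR_nat_ge1.
  have [|F [sepF bF]] := sepD _ (nearG v); first by rewrite card_induced.
  have [F' [bF' sepF' subF']] := lift_separator sepF.
  exists F'; split=> //.
  apply: (@le_trans _ _ #|F|%:R); first by rewrite ler_nat.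
  apply: le_trans bF _.
  (* [A] may be negative, so it is replaced by the maximum before the power is enlarged. *)
  apply: (@le_trans _ _ (Num.max A 1 * #|induced (~: closed_neigh v)|%:R `^ c)).
    by rewrite ler_wpM2r ?powR_ge0 // le_max lexx.
  rewrite ler_wpM2l ?le_max ?ler01 ?orbT //; apply: powR_nat_le.
  by rewrite card_induced max_card.
have [F HF] := choice piece.
have [||E [sepE bE]] := @nearly_separator G F.
- by move=> v; case: (HF v).
- by move=> v; case: (HF v).
exists E; split=> //.
apply: (@le_trans _ _ (\sum_v #|F v|).+1%:R); first by rewrite ler_nat.
rewrite -add1n natrD lerD2l natr_sum.
rewrite mulr_natl -(sumr_const G); apply: ler_sum => v _.
by case: (HF v).
Qed.

Lemma weight_bound_add (G H1 H2 : sgraph) (B : R) : 0 <= B ->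
  (#|H1| <= #|G|)%N -> (#|H2| <= #|G|)%N ->
  (weight H1 + weight H2 <= weight G)%N ->
  B * (weight H1)%:R * #|H1|%:R `^ c + B * (weight H2)%:R * #|H2|%:R `^ c
    <= B * (weight G)%:R * #|G|%:R `^ c.
Proof.
move=> B_ge0 l1 l2 w12.
apply: (@le_trans _ _ (B * (weight H1)%:R * #|G|%:R `^ c +
    B * (weight H2)%:R * #|G|%:R `^ c)).
  by apply: lerD; rewrite ler_wpM2l ?mulr_ge0 ?ler0n ?powR_nat_le.
rewrite -mulrDl -mulrDr ler_wpM2r ?powR_ge0 // ler_wpM2l //.
by rewrite -natrD ler_nat.
Qed.

Lemma separable_weight (C : graph_class) (B : R) : 0 <= B -> hereditary C ->
  (forall G, C G -> (0 < #|G|)%N -> prime_graph G -> atom G ->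
     separable G (B * (weight G)%:R * #|G|%:R `^ c)) ->
  forall G, C G -> (0 < #|G|)%N ->
     separable G (B * (weight G)%:R * #|G|%:R `^ c).
Proof.
move=> B_ge0 hC base G.
have [n] := ubnP #|G|; elim: n G => // n IHn G ltGn CG G_gt0.
have piece (W : {set G}) : (0 < #|W| < #|G|)%N -> exists F : {set {set G}},
    [/\ separates_on W F, (forall U, U \in F -> U \subset W) &
      #|F|%:R <= B * (weight (induced W))%:R * #|induced W|%:R `^ c].
  case/andP=> W_gt0 WG.
  have [|||F [sepF bF]] := IHn (induced W); rewrite ?card_induced //.
  - by apply: leq_trans WG _; rewrite -ltnS.
  - exact: hC CG (induced_subgraph_induced W).
  have [F' [bF' sepF' subF']] := lift_separator sepF.
  exists F'; split=> //; rewrite -card_induced.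
  by apply: le_trans bF; rewrite ler_nat.
have combine (W1 W2 : {set G}) (E F1 F2 : {set {set G}}) :
    (#|E| <= #|F1| + #|F2|)%N ->
    #|F1|%:R <= B * (weight (induced W1))%:R * #|induced W1|%:R `^ c ->
    #|F2|%:R <= B * (weight (induced W2))%:R * #|induced W2|%:R `^ c ->
    (weight (induced W1) + weight (induced W2) <= weight G)%N ->
    #|E|%:R <= B * (weight G)%:R * #|G|%:R `^ c.
  move=> bE b1 b2 w12.
  apply: (@le_trans _ _ (#|F1| + #|F2|)%:R); first by rewrite ler_nat.
  rewrite natrD; apply: le_trans (lerD b1 b2) _.
  by apply: weight_bound_add => //; rewrite card_induced max_card.
have [primeG|/existsNP[M /not_implyP[modM ntM]]] := EM (prime_graph G); last first.
  have [M0 _] := modM; have [m mM] := set0Pn _ M0.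
  have M_gt0 : (0 < #|M|)%N by apply/card_gt0P; exists m.
  have M_n1 : #|M| <> 1%N by move=> M1; apply: ntM; left.
  have M_lt : (#|M| < #|G|)%N.
    rewrite ltn_neqAle max_card andbT; apply/eqP => eMG; apply: ntM; right.
    by apply/eqP; rewrite eqEcard subsetT cardsT eMG /=.
  (* The two pieces share exactly [m], so their orders minus one add up to that of [G] minus one. *)
  have cardW2 : (#|m |: ~: M| + #|M| = #|G|.+1)%N.
    by rewrite cardsU1 !inE mM -(cardsC M); lia.
  have [|F1 [sep1 sub1 b1]] := piece M; first by rewrite M_gt0.
  have [|F2 [sep2 sub2 b2]] := piece (m |: ~: M); first by lia.
  have [E [sepE bE]] := module_separator modM mM sep1 sub1 sep2.
  exists E; split=> //; apply: (combine _ _ _ _ _ bE b1 b2).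
  have cM : clique (M :&: (m |: ~: M)).
    move=> x y; rewrite !inE => /andP[-> /=]; rewrite orbF => /eqP->.
    by move=> /andP[-> /=]; rewrite orbF => /eqP->; rewrite eqxx.
  have := nonadjacent_pairs_induced (b := false) cM.
  rewrite addn0 => /(_ ltac:(by [])).
  rewrite /weight !card_induced.
  move: #|nonadjacent_pairs _| #|nonadjacent_pairs _| #|nonadjacent_pairs _|.
  move=> q m2 m1 m12.
  (* Since [M] is nontrivial, both pieces have at least two vertices and each [maxn] reduces to its
     first argument. *)
  have -> : maxn #|M|.-1 1 = #|M|.-1 by lia.
  have -> : maxn #|m |: ~: M|.-1 1 = #|m |: ~: M|.-1 by lia.
  have -> : maxn #|G|.-1 1 = (#|M|.-1 + #|m |: ~: M|.-1)%N by lia.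
  by rewrite mulnDr leq_add // leq_mul2r; apply/orP; right; lia.
have [atomG|/existsNP[K /contrapT cutK]] := EM (atom G); first exact: base.
have [W1 [W2 [W12 cW nadj /subsetPn[y _ yW1] /subsetPn[x _ xW2]]]] := cutset_split cutK.
have xy : x != y.
  by apply: contraNneq yW1 => <-; have := in_setT x; rewrite -W12 inE (negbTE xW2) orbF.
have card_side (W : {set G}) (u v : G) : u \in W -> v \notin W -> (0 < #|W| < #|G|)%N.
  move=> uW vW; apply/andP; split; first by apply/card_gt0P; exists u.
  by rewrite -cardsT; apply/proper_card/properP; split; [apply: subsetT | exists v].
have xW1 : x \in W1.
  by have := in_setT x; rewrite -W12 inE (negbTE xW2) orbF.
have yW2 : y \in W2 by have := in_setT y; rewrite -W12 inE (negbTE yW1).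
have sz1 := card_side _ _ _ xW1 yW1; have sz2 := card_side _ _ _ yW2 xW2.
have [F1 [sep1 sub1 b1]] := piece W1 sz1.
have [F2 [sep2 sub2 b2]] := piece W2 sz2.
have [E [sepE bE]] := cutset_separator W12 nadj sep1 sub1 sep2 sub2.
exists E; split=> //; apply: (combine _ _ _ _ _ bE b1 b2).
(* The pair [(x, y)] across the cutset provides the extra unit needed to add the two successors in
   the weights. *)
have := nonadjacent_pairs_induced (b := true) cW.
move=> /(_ (fun _ => ex_intro _ x (ex_intro _ y (And4 xW2 yW1 xy (nadj x y xW2 yW1))))).
rewrite /weight !card_induced.
move: #|nonadjacent_pairs _| #|nonadjacent_pairs _| #|nonadjacent_pairs _|.
move=> q m2 m1 m12.
apply: (@leq_trans ((m1.+1 + m2.+1) * maxn #|G|.-1 1)).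
  by rewrite mulnDl; apply: leq_add; apply: leq_mul => //; lia.
by rewrite leq_mul2r; apply/orP; right; lia.
Qed.

End Bound.

Theorem theorem5 (R : realType) (c : R) (C C' : graph_class) :
  hereditary C -> 1 <= c ->
  CS_separation_property c C' ->
  (forall G : sgraph, C G -> prime_graph G -> atom G -> nearly C' G) ->
  CS_separation_property (c + 3) C.
Proof.
move=> hC c_ge1 [A sepC'] primeC.
have c_ge0 : 0 <= c := le_trans ler01 c_ge1.
(* The 1 pays for the additional cut of a prime atom; the 2 comes from [#|G| <= 2 * weight G]. *)
pose B : R := 1 + 2 * Num.max A 1.
have A_ge1 : 1 <= Num.max A 1 by rewrite le_max lexx orbT.
have B_ge0 : 0 <= B by rewrite /B; lra.
exists B => H CH H_gt0.
have [|F [sepF bF]] := separable_weight c_ge0 B_ge0 hC _ CH H_gt0.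
  move=> G CG G_gt0 primeG atomG.
  have [F [sepF bF]] := nearly_separable c_ge0 sepC' (primeC G CG primeG atomG).
  exists F; split=> //; apply: le_trans bF _.
  have G2 : (#|G| <= 2 * weight G)%N.
    by rewrite /weight mulSn; lia.
  have w1 : (1 <= weight G)%N by rewrite /weight muln_gt0; lia.
  have := powR_nat_ge1 c_ge0 G_gt0; set t := _ `^ c => t1.
  rewrite /B mulrDl mulrDl mul1r; apply: lerD.
    by rewrite -[leLHS]mulr1 ler_pM ?ler01 ?ler1n.
  rewrite mulrA ler_wpM2r //; first by lra.
  rewrite [leLHS]mulrC -mulrA mulrCA ler_wpM2l //; first by lra.
  by rewrite -natrM ler_nat.
exists F; split=> //; apply: le_trans bF _.
rewrite -mulrA ler_wpM2l // powRD; last by rewrite pnatr_eq0 -lt0n H_gt0 implybT.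
rewrite powR_mulrn // mulrC ler_wpM2l ?powR_ge0 // -natrX ler_nat.
rewrite /weight expnSr leq_mul ?card_nonadjacent_pairs //; lia.
Qed.
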